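(* Let $d\ge 2$, and suppose $\mathcal{X}\in\mathbb{C}^{n_1\times\cdots\times n_d}$ satisfies the multidimensional Sylvester equation $$\mathcal{X}\times_1 A^{(1)}+\cdots+\mathcal{X}\times_d A^{(d)}=\mathcal{G},\qquad A^{(k)}\in\mathbb{C}^{n_k\times n_k},\quad \mathcal{G}\in\mathbb{C}^{n_1\times\cdots\times n_d},$$ where the normal matrices $A^{(1)},\dots,A^{(d)}$ are Minkowski sum separated with disjoint sets $E_j$ and $F_j$ for $1\le j\le d-1$. Then, for a fixed $0<\epsilon<1$, $$p^{\rm TT}_\epsilon(\mathcal{X})\le\sum_{j=1}^d (k_{j-1}\nu_{j-1})(k_j\nu_j)\,n_j,\qquad \nu_j=\mathrm{rank}(G_j),\quad 1\le j\le d-1,$$ with the convention $k_0\nu_0=k_d\nu_d=1$, where $G_j$ is the $j$th unfolding of $\mathcal{G}$ and, for $1\le j\le d-1$, $k_j$ is an integer such that $Z_{k_j}(E_j,F_j)\le \epsilon/\sqrt{d}$.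
   Context: Mode product: $(\mathcal{X}\times_k A)_{i_1,\ldots,i_{k-1},j,i_{k+1},\ldots,i_d}=\sum_{i_k=1}^{n_k}\mathcal{X}_{i_1,\ldots,i_d}A_{j,i_k}$. Frobenius norm: $\|\mathcal{X}\|_F^2=\sum_{i_1,\dots,i_d}|\mathcal{X}_{i_1,\ldots,i_d}|^2$. Unfolding: the $j$th unfolding $G_j$ of $\mathcal{G}$ is the matrix of size $(\prod_{s=1}^j n_s)\times(\prod_{s=j+1}^d n_s)$ obtained by reshaping $\mathcal{G}$ so that rows are indexed by $(i_1,\dots,i_j)$ and columns by $(i_{j+1},\dots,i_d)$ (MATLAB reshape ordering). Tensor-train format: $\mathcal{Y}\in\mathbb{C}^{n_1\times\cdots\times n_d}$ has tensor-train rank at most $(s_0,\ldots,s_d)$, with $s_0=s_d=1$, if there are matrix-valued functions $H_k:\{1,\ldots,n_k\}\to\mathbb{C}^{s_{k-1}\times s_k}$, $1\le k\le d$, with $\mathcal{Y}_{i_1,\ldots,i_d}=H_1(i_1)H_2(i_2)\cdots H_d(i_d)$ for all indices. Storing such a decomposition takes $\sum_{k=1}^d s_{k-1}s_kn_k$ degrees of freedom. For $0<\epsilon<1$, $p^{\rm TT}_\epsilon(\mathcal{X})$ denotes the smallest number of degrees of freedom with which one can store, in tensor-train format, some tensor $\tilde{\mathcal{X}}$ satisfying $\|\mathcal{X}-\tilde{\mathcal{X}}\|_F\le\epsilon\|\mathcal{X}\|_F$. Minkowski sum separated: normal matrices $A^{(1)},\ldots,A^{(d)}$ are Minkowski sum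 separated if there are disjoint sets $E_j,F_j\subseteq\mathbb{C}$ such that $\Lambda(A^{(1)})+\cdots+\Lambda(A^{(j)})\subseteq E_j$ and $-(\Lambda(A^{(j+1)})+\cdots+\Lambda(A^{(d)}))\subseteq F_j$ for $1\le j\le d-1$, where $\Lambda(\cdot)$ denotes the spectrum and set sums are Minkowski sums. Zolotarev number: for disjoint sets $E,F\subseteq\mathbb{C}$ and an integer $k\ge0$, $$Z_k(E,F)=\inf_{r\in\mathcal{R}_{k,k}}\frac{\sup_{z\in E}|r(z)|}{\inf_{z\in F}|r(z)|},$$ where $\mathcal{R}_{k,k}$ is the set of irreducible rational functions $p/q$ with polynomials $p,q$ of degree at most $k$. *)

(* Defs.v *)
From mathcomp Require Import all_boot all_order all_algebra.
From mathcomp Require Export complex.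
From mathcomp Require Import boolp classical_sets reals constructive_ereal ereal.

Set Implicit Arguments.
Unset Strict Implicit.
Unset Printing Implicit Defensive.

Import Order.TTheory GRing.Theory Num.Theory.

Local Open Scope ring_scope.
Local Open Scope classical_set_scope.

(* Modes are numbered from 0: [k : 'I_d] is the mode k + 1 of the usual
   1-based notation.  Cuts between modes are numbered by j : nat as usual:
   cut j, 1 <= j <= d - 1, separates the first j modes from the others. *)

Notation midx n := {dffun forall k, 'I_(n k)}.
Notation tensor R n := {ffun midx n -> R[i]}.

Section Tensors.
Variables (R : realType) (d : nat) (n : 'I_d -> nat).
Implicit Types (X G : tensor R n) (i : midx n).

Definition mode_prod X (k : 'I_d) (A : 'M[R[i]]_(n k)) : tensor R n :=
  [ffun i : midx n =>
    \sum_(m < n k) X [ffun l => dfwith i m l] * A (i k) m].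

Definition frob X : R := Num.sqrt (\sum_i Normc.normc (X i) ^+ 2).

(* Column-major (MATLAB) ordering: the multi-index i is stored at the position
   \sum_k i k * stride k. *)
Definition stride (j : nat) : nat := (\prod_(s < d | s < j) n s)%N.
Definition costride (j : nat) : nat := (\prod_(s < d | j <= s) n s)%N.

Lemma midx_at_subproof (j : nat) (a : 'I_(stride j)) (b : 'I_(costride j))
    (k : 'I_d) (v : nat) : (v %% n k < n k)%N.
Proof.
rewrite ltn_pmod // lt0n; apply/eqP => nk0.
case: (ltnP k j) => hk.
  by case: a => a; rewrite /stride (bigD1 k) //= nk0 mul0n.
by case: b => b; rewrite /costride (bigD1 k) //= nk0 mul0n.
Qed.

(* The multi-index stored at the position a + b * stride j. *)
Definition midx_at (j : nat) (a : 'I_(stride j)) (b : 'I_(costride j)) :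
    midx n :=
  [ffun k : 'I_d => Ordinal
    (midx_at_subproof a b k ((a + b * stride j) %/ stride k))].

Definition unfolding G (j : nat) : 'M[R[i]]_(stride j, costride j) :=
  \matrix_(a, b) G (midx_at a b).

(* The cores H k have size s k x s k.+1, so the TT ranks are s 0, ..., s d.
   A rank may be 0, in which case the represented tensor is 0. *)
Fixpoint tt_prod (s : nat -> nat)
    (H : forall k : 'I_d, 'I_(n k) -> 'M[R[i]]_(s k, s k.+1))
    (i : midx n) (m : nat) : (m <= d)%N -> 'M[R[i]]_(s 0, s m) :=
  match m with
  | 0 => fun _ => 1%:M
  | m'.+1 => fun lt_m'd =>
      tt_prod H i (ltnW lt_m'd) *m H (Ordinal lt_m'd) (i (Ordinal lt_m'd))
  end.

(* The product of the cores is a 1 x 1 matrix, identified with its entry. *)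
Definition tt_format (s : nat -> nat) (Y : tensor R n) : Prop :=
  [/\ s 0 = 1%N, s d = 1%N &
    exists H : forall k : 'I_d, 'I_(n k) -> 'M[R[i]]_(s k, s k.+1),
      forall i (a : 'I_(s 0)) (b : 'I_(s d)),
        Y i = tt_prod H i (leqnn d) a b].

Definition tt_dof (s : nat -> nat) : nat :=
  (\sum_(k < d) s k * s k.+1 * n k)%N.

Definition tt_storable (eps : R) X (N : nat) : Prop :=
  exists (s : nat -> nat) (Y : tensor R n),
    [/\ tt_format s Y, frob (X - Y) <= eps * frob X & N = tt_dof s].

(* The least N such that tt_storable eps X N; such an N exists as soon as
   0 < d and 0 <= eps, see tt_storable_ex, so that the value 0 is not used. *)
Definition pTT (eps : R) X : nat :=
  if pselect (exists N, `[< tt_storable eps X N >]) is left exN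
  then ex_minn exN else 0%N.

Lemma pTTP (eps : R) X : (exists N, tt_storable eps X N) ->
  tt_storable eps X (pTT eps X) /\
  forall N, tt_storable eps X N -> (pTT eps X <= N)%N.
Proof.
move=> [N0 hN0]; rewrite /pTT; case: pselect => [exN|[]]; last first.
  by exists N0; apply/asboolP.
case: ex_minnP => m /asboolP hm mmin; split=> // N hN.
by apply: mmin; apply/asboolP.
Qed.

Lemma tt_storable_ex (eps : R) X : (0 < d)%N -> 0 <= eps ->
  exists N, tt_storable eps X N.
Proof.
move=> d_gt0 eps_ge0.
pose s (j : nat) := if (0 < j < d)%N then #|{: midx n}| else 1%N.
have fX0 : frob 0 = 0.
  rewrite /frob big1 ?sqrtr0 // => i _.
  by rewrite ffunE Normc.normc0 expr0n.
exists (tt_dof s), s, X; split=> //; last first.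
  by rewrite subrr fX0 mulr_ge0 // sqrtr_ge0.
split; rewrite /s ?ltnn ?andbF //.
pose last (k : nat) (l : midx n) : R[i] := if k.+1 == d then X l else 1.
pose H (k : 'I_d) (m : 'I_(n k)) : 'M[R[i]]_(s k, s k.+1) :=
  \matrix_(a, b) \sum_(l : midx n |
    [&& (k == 0%N :> nat) || (val a == enum_rank l),
        (k.+1 == d) || (val b == enum_rank l) & l k == m]) last k l.
have tt_prodE i m (ltmd : (m < d)%N) a b :
    tt_prod H i ltmd a b = \sum_(l : midx n |
      ((m.+1 == d) || (val b == enum_rank l)) &&
      [forall t : 'I_d, (t < m.+1)%N ==> (l t == i t)]) last m l.
  elim: m ltmd a b => [|m IHm] ltmd a b.
    rewrite /= mul1mx mxE; apply: eq_bigl => l /=; congr (_ && _).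
    apply/idP/forallP => [/eqP h t|/(_ (Ordinal ltmd))]; last by rewrite implyTb.
    apply/implyP; rewrite ltnS leqn0 => /eqP t0.
    have -> : t = Ordinal ltmd by apply: val_inj.
    exact/eqP.
  rewrite [tt_prod _ _ _]/= mxE.
  have sm : s m.+1 = #|{: midx n}| by rewrite /s ltmd.
  have neqd : (m.+1 == d) = false by rewrite ltn_eqF.
  under eq_bigr => c _.
    rewrite IHm mxE /= neqd /=.
    under eq_bigr do rewrite /last neqd.
    over.
  pose f (l : midx n) : 'I_(s m.+1) := cast_ord (esym sm) (enum_rank l).
  rewrite (reindex f) /=; last first.
    exists (fun c => enum_val (cast_ord sm c)) => [l|c] _.
      by rewrite /f cast_ordKV enum_rankK.
    by rewrite /f enum_valK cast_ordK.
  have eqf (l l' : midx n) : (val (f l) == enum_rank l' :> nat) = (l' == l).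
    by rewrite /= (inj_eq val_inj) (inj_eq enum_rank_inj) eq_sym.
  rewrite [RHS]big_mkcond /=; apply: eq_bigr => l _.
  rewrite (eq_bigl (fun l' => (l' == l) &&
    [forall t : 'I_d, (t < m.+1)%N ==> (l' t == i t)])); last first.
    by move=> l'; rewrite eqf.
  rewrite [X in _ * X](eq_bigl (fun l' => (l' == l) &&
    (((m.+2 == d) || (val b == enum_rank l')) &&
     (l' (Ordinal ltmd) == i (Ordinal ltmd))))); last first.
    by move=> l'; rewrite eqf.
  rewrite big_mkcondr big_pred1_eq big_mkcondr big_pred1_eq.
  have -> : [forall t : 'I_d, (t < m.+2)%N ==> (l t == i t)] =
    [forall t : 'I_d, (t < m.+1)%N ==> (l t == i t)] &&
    (l (Ordinal ltmd) == i (Ordinal ltmd)).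
    apply/forallP/andP => [h|[/forallP h /eqP hm] t]; last first.
      apply/implyP; rewrite ltnS leq_eqVlt => /orP[/eqP tm|tm].
        have -> : t = Ordinal ltmd by apply: val_inj.
        by rewrite hm.
      exact: implyP (h t) tm.
    split; last by have := h (Ordinal ltmd); rewrite /= ltnSn.
    apply/forallP => t; apply/implyP => tm.
    exact: implyP (h t) (ltnW tm).
  rewrite [in RHS]andbCA.
  by case: ifP => _; rewrite ?mul1r ?mul0r.
exists H => i a b.
have ltd : (d.-1 < d)%N by rewrite prednK.
have dE : (d.-1.+1 == d) by rewrite prednK.
have H1 (m : nat) (em : m = d.-1.+1) (le : (m <= d)%N) (c : 'I_(s m)) :
    tt_prod H i le a c = X i.
  subst m; rewrite tt_prodE (big_pred1 i) /=.
    by rewrite /last dE.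
  move=> l; rewrite dE /=.
  apply/forallP/eqP => [h|-> t]; last by rewrite eqxx implybT.
  by apply/ffunP => t; apply/eqP; have := h t; rewrite (eqP dE) ltn_ord.
by rewrite H1 ?(eqP dE).
Qed.

End Tensors.

Section Sylvester.
Variables (R : realType) (d : nat) (n : 'I_d -> nat).

Definition spectrum (m : nat) (A : 'M[R[i]]_m) : set R[i] :=
  [set z | eigenvalue A z].

Definition minkowski_sum (I : finType) (P : pred I) (S : I -> set R[i]) :
    set R[i] :=
  [set z | exists2 w : I -> R[i],
    (forall k, P k -> S k (w k)) & z = \sum_(k | P k) w k].

Definition minkowski_sum_separated (A : forall k : 'I_d, 'M[R[i]]_(n k))
    (E F : nat -> set R[i]) : Prop :=
  forall j : nat, (0 < j < d)%N ->
  [/\ E j `&` F j = set0,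
      minkowski_sum (fun k : 'I_d => (k < j)%N) (fun k => spectrum (A k))
        `<=` E j &
      [set - z | z in minkowski_sum (fun k : 'I_d => (j <= k)%N)
                                    (fun k => spectrum (A k))]
        `<=` F j].

End Sylvester.

Section Zolotarev.
Variable R : realType.
Implicit Types (p q : {poly R[i]}) (E F : set R[i]).
Local Open Scope ereal_scope.

(* |p z / q z|, for coprime p and q: the zeros of q are poles. *)
Definition abs_ratfun p q (z : R[i]) : \bar R :=
  if root q z then +oo else (Normc.normc (p.[z] / q.[z]))%:E.

(* The quotient sup_E |r| / inf_F |r|.  It is +oo when its denominator is 0 or
   its numerator is +oo: rational functions for which the quotient reads 0 / 0
   (r = 0 in particular) or oo / oo do not contribute to the infimum in zolo.
   When inf_F |r| = +oo and sup_E |r| is finite, the quotient is 0. *)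
Definition zolo_quotient E F p q : \bar R :=
  let num := ereal_sup [set abs_ratfun p q z | z in E] in
  let den := ereal_inf [set abs_ratfun p q z | z in F] in
  if (num == +oo) || (den == 0) then +oo else num / den.

Definition zolo (k : nat) E F : \bar R :=
  ereal_inf [set x | exists p q,
    [/\ (size p <= k.+1)%N, (size q <= k.+1)%N, q != 0%R, coprimep p q &
        x = zolo_quotient E F p q]].

End Zolotarev.

(* Main.v *)
(* In the common eigenbases of the normal matrices (a unitary change of basis in
   every mode), the equation is diagonal: at the cut j it reads
   (la i - mu i) * X i = G i, where la depends only on the first j modes and
   takes values in E j, and mu depends only on the others and takes values in
   F j.  Given r = p / q, the tensor
     Y i = X i * (1 - (p (la i) * q (mu i)) / (q (la i) * p (mu i)))
   satisfies |X - Y| <= (sup_E |r| / inf_F |r|) |X| entrywise, and its jth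
   unfolding has rank at most k * rank G_j, because the Bezoutian
   (q x * p y - p x * q y) / (x - y) is a sum of k products f(x) g(y).
   Replacing the approximants by orthogonal projections, applied successively
   from the last cut to the first, gives a tensor in TT format; by Pythagoras
   the squares of the d - 1 errors add up.  As the Zolotarev numbers are at most
   eps / sqrt d < eps / sqrt (d - 1), the infima need not be attained. *)

Require Import Defs.
From mathcomp Require Import all_boot all_order all_algebra.
From mathcomp Require Import boolp classical_sets reals constructive_ereal ereal.
From mathcomp Require Import ring.

Set Implicit Arguments.
Unset Strict Implicit.
Unset Printing Implicit Defensive.

Import Order.TTheory GRing.Theory Num.Theory.

Local Open Scope ring_scope.
Local Open Scope sesquilinear_scope.

(** * Sums over multi-indices, and functions of one side of a cut *)

Lemma bigA_distr_midx (C : comNzRingType) d (n : 'I_d -> nat)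
    (F : forall k : 'I_d, 'I_(n k) -> C) :
  \prod_k \sum_m F k m = \sum_(i : midx n) \prod_k F k (i k).
Proof.
pose T_ k : finType := 'I_(n k).
rewrite (reindex (@dffun_of_fprod _ T_)); last first.
  exact/onW_bij/dffun_of_fprod_bij.
pose P_ (k : 'I_d) : {ffun T_ k -> C} := [ffun m => F k m].
transitivity (\sum_(t : fprod T_) \prod_(k in 'I_d) P_ k (t k)); last first.
  by apply: eq_bigr => t _; apply: eq_bigr => k _; rewrite !ffunE.
(* The dependent family becomes an ordinary function into a tagged union, to which the
   distributivity law for plain functions applies. *)
rewrite big_fprod.
apply: etrans (bigA_distr_big_dep (fun k => mem (tagged_with T_ k))
  (fun k => untag 0 (P_ k))).
apply: eq_bigr => k _; rewrite -(big_tag (fun k => P_ k)).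
by apply: eq_bigr => m _; rewrite ffunE.
Qed.

Section Cuts.
Variables (d : nat) (n : 'I_d -> nat).
Implicit Types (i p s : midx n) (j : nat).

Definition midx_merge j p s : midx n :=
  [ffun k : 'I_d => if (k < j)%N then p k else s k].

Definition prefix_only (T : Type) j (f : midx n -> T) :=
  forall i i', (forall k : 'I_d, (k < j)%N -> i k = i' k) -> f i = f i'.

Definition suffix_only (T : Type) j (f : midx n -> T) :=
  forall i i', (forall k : 'I_d, (j <= k)%N -> i k = i' k) -> f i = f i'.

Lemma prefix_merge T j (f : midx n -> T) p s :
  prefix_only j f -> f (midx_merge j p s) = f p.
Proof. by move=> hf; apply: hf => k kj; rewrite ffunE kj. Qed.

Lemma suffix_merge T j (f : midx n -> T) p s :
  suffix_only j f -> f (midx_merge j p s) = f s.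
Proof.
by move=> hf; apply: hf => k; rewrite leqNgt => /negPf kj; rewrite ffunE kj.
Qed.

Lemma suffix_onlyW T j j' (f : midx n -> T) :
  (j <= j')%N -> suffix_only j' f -> suffix_only j f.
Proof.
by move=> jj' hf i i' e; apply: hf => k /(leq_trans jj') jk; apply: e.
Qed.

Lemma midx_merge_merge j p q s :
  midx_merge j q (midx_merge j p s) = midx_merge j q s.
Proof. by apply/ffunP => k; rewrite !ffunE; case: (k < j)%N. Qed.

Lemma midx_merge0 p s : midx_merge 0 p s = s.
Proof. by apply/ffunP => k; rewrite !ffunE ltn0. Qed.

Lemma swap_merge_involutive j :
  involutive (fun u : midx n * midx n =>
    (midx_merge j u.1 u.2, midx_merge j u.2 u.1)).
Proof.
case=> p s; congr (_, _); apply/ffunP => k; rewrite !ffunE /=;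
  by case: (k < j)%N.
Qed.

(** Exchanging the modes >= j of two multi-indices permutes the pairs. *)
Lemma sum_merge (V : nmodType) j (f : midx n -> midx n -> V) :
  \sum_p \sum_s f p s = \sum_p \sum_s f (midx_merge j p s) (midx_merge j s p).
Proof.
rewrite !pair_bigA /= (reindex_inj (inv_inj (swap_merge_involutive j))) /=.
exact: eq_bigr.
Qed.

Lemma sum_merge1 (V : nmodType) j (f : midx n -> V) :
  \sum_p \sum_s f (midx_merge j p s) = (\sum_i f i) *+ #|{: midx n}|.
Proof.
rewrite -(sum_merge j (fun p _ => f p)) exchange_big /= sumr_const.
by congr (_ *+ _); apply: eq_card.
Qed.

(** Each product of values at [p] and [s] is the value of [f * g] at their merge, and every
    multi-index is the merge of [#|midx n|] pairs. *)
Lemma sum_prefix_suffix (C : pzSemiRingType) j (f g : midx n -> C) :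
  prefix_only j f -> suffix_only j g ->
  (\sum_i f i) * (\sum_i g i) = (\sum_i f i * g i) *+ #|{: midx n}|.
Proof.
move=> hf hg; rewrite -(sum_merge1 j) big_distrlr /=.
apply: eq_bigr => p _; apply: eq_bigr => s _.
by rewrite (prefix_merge _ _ hf) (suffix_merge _ _ hg).
Qed.

(** A bound on the rank of the [j]th unfolding. The factors take full multi-indices and ignore the
    modes across the cut, so that their type does not depend on [j]. *)
Definition cut_rank_le (C : pzSemiRingType) j r (T : {ffun midx n -> C}) :=
  exists a b : 'I_r -> midx n -> C,
    [/\ forall l, prefix_only j (a l), forall l, suffix_only j (b l) &
        forall i, T i = \sum_l a l i * b l i].

End Cuts.

(** * Column-major positions as mixed-radix expansions *)

Section Positions.
Variables (d : nat) (n : 'I_d -> nat).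
Implicit Types (i : midx n) (j : nat).

Definition pos_head j i : nat := (\sum_(k < d | k < j) i k * stride n k)%N.
Definition pos_tail j i : nat := (\sum_(k < d | j <= k) i k * stride n k)%N.

Lemma big_ord_ltS (T : Type) (idx : T) (op : Monoid.com_law idx) (k : 'I_d)
    (F : 'I_d -> T) :
  \big[op/idx]_(s < d | (s < k.+1)%N) F s =
  op (F k) (\big[op/idx]_(s < d | (s < k)%N) F s).
Proof.
rewrite (bigD1 k) //=; congr (op _ _); apply: eq_bigl => s.
by rewrite [RHS]ltn_neqAle andbC -ltnS.
Qed.

Lemma strideS (k : 'I_d) : stride n k.+1 = (n k * stride n k)%N.
Proof. exact: big_ord_ltS. Qed.

Lemma pos_headS (k : 'I_d) i :
  pos_head k.+1 i = (i k * stride n k + pos_head k i)%N.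
Proof. exact: big_ord_ltS. Qed.

Lemma pos_tailS (k : 'I_d) i :
  pos_tail k i = (i k * stride n k + pos_tail k.+1 i)%N.
Proof.
rewrite /pos_tail (bigD1 k) //=; congr (_ + _)%N; apply: eq_bigl => s.
by rewrite [RHS]ltn_neqAle andbC eq_sym.
Qed.

Lemma pos_head_tail j i : (pos_head j i + pos_tail j i)%N = pos_head d i.
Proof.
rewrite /pos_head [RHS](eq_bigl xpredT) => [|k]; last exact: ltn_ord.
rewrite [RHS](bigID (fun k : 'I_d => (k < j)%N)) /=; congr (_ + _)%N.
by apply: eq_bigl => k; rewrite leqNgt.
Qed.

Lemma pos_head_lt j i : (pos_head j i < stride n j)%N.
Proof.
elim: j => [|j IHj]; first by rewrite /pos_head /stride !big_pred0.
have [jd|dj] := ltnP j d; last first.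
  have e (k : 'I_d) : (k < j.+1)%N = (k < j)%N.
    by rewrite !(leq_trans (ltn_ord k)) // leqW.
  by rewrite /pos_head /stride !(eq_bigl _ _ e).
rewrite (pos_headS (Ordinal jd)) (strideS (Ordinal jd)) /=.
apply: (@leq_trans ((i (Ordinal jd)).+1 * stride n j)%N).
  by rewrite mulSn addnC ltn_add2r.
by rewrite leq_mul2r ltn_ord orbT.
Qed.

Lemma dvdn_stride j j' : (j <= j')%N -> (stride n j %| stride n j')%N.
Proof.
move=> jj'; rewrite [X in (_ %| X)%N](bigID (fun k : 'I_d => (k < j)%N)) /=.
rewrite (eq_bigl (fun k : 'I_d => (k < j)%N)) ?dvdn_mulr // => k.
by case: (ltnP k j) => kj; rewrite ?andbF // (leq_trans kj jj').
Qed.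

Lemma dvdn_pos_tail j i : (stride n j %| pos_tail j i)%N.
Proof. by apply: dvdn_sum => k jk; rewrite dvdn_mull ?dvdn_stride. Qed.

Lemma stride_costride j : (stride n d = stride n j * costride n j)%N.
Proof.
rewrite /stride /costride [LHS](eq_bigl xpredT) => [|k]; last exact: ltn_ord.
rewrite (bigID (fun k : 'I_d => (k < j)%N)) /=; congr (_ * _)%N.
by apply: eq_bigl => k; rewrite -leqNgt.
Qed.

(** The digits below [k] add up to less than [stride n k], so the division removes them; those above
    contribute a multiple of [stride n k.+1 = n k * stride n k], which vanishes modulo [n k] after
    the division. *)
Lemma pos_digit (k : 'I_d) i : ((pos_head d i %/ stride n k) %% n k)%N = i k.
Proof.
have st_gt0 : (0 < stride n k)%N by apply: leq_ltn_trans (pos_head_lt k i).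
rewrite -(pos_head_tail k) divnDr ?dvdn_pos_tail //.
rewrite divn_small ?pos_head_lt // add0n pos_tailS divnMDl //.
have /dvdnP[t ->] := dvdn_pos_tail k.+1 i.
by rewrite strideS mulnA mulnK // addnC modnMDl modn_small.
Qed.

Lemma pos_tail_lt j i : (pos_tail j i %/ stride n j < costride n j)%N.
Proof.
rewrite ltn_divLR; last exact: leq_ltn_trans (pos_head_lt j i).
rewrite mulnC -stride_costride.
apply: leq_ltn_trans (leq_addl (pos_head j i) _) _.
by rewrite pos_head_tail pos_head_lt.
Qed.

Lemma midx_at_pos j i :
  midx_at (Ordinal (pos_head_lt j i)) (Ordinal (pos_tail_lt j i)) = i.
Proof.
apply/ffunP => k; apply: val_inj; rewrite ffunE /=.
by rewrite divnK ?dvdn_pos_tail // pos_head_tail pos_digit.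
Qed.

(** A full-rank factorization of the unfolding, read at the positions of the head and of the tail of
    [i]. *)
Lemma cut_rank_unfolding (R : realType) (G : tensor R n) j :
  cut_rank_le j (\rank (unfolding G j)) G.
Proof.
set M := unfolding G j.
exists (fun l i => col_base M (Ordinal (pos_head_lt j i)) l).
exists (fun l i => row_base M l (Ordinal (pos_tail_lt j i))).
split=> [l i i' e|l i i' e|i].
- congr (col_base M _ _); apply: val_inj => /=.
  by apply: eq_bigr => k kj; rewrite e.
- congr (row_base M _ _); apply: val_inj => /=.
  by congr (_ %/ _)%N; apply: eq_bigr => k kj; rewrite e.
- rewrite -{1}(midx_at_pos j i).
  transitivity (M (Ordinal (pos_head_lt j i)) (Ordinal (pos_tail_lt j i))).
    by rewrite mxE.
  by rewrite -{1}(mulmx_base M) mxE.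
Qed.

End Positions.

(** * Linear maps acting in all modes at once *)

Section ModeTransforms.
Variables (C : numClosedFieldType) (d : nat) (n : 'I_d -> nat).
Implicit Types (U V : forall k : 'I_d, 'M[C]_(n k)) (X Y : {ffun midx n -> C}).

(** The Kronecker product of the [U k] applied to [X], also known as the Tucker product. *)
Definition multi_prod U X : {ffun midx n -> C} :=
  [ffun i : midx n => \sum_(l : midx n) (\prod_k U k (i k) (l k)) * X l].

Definition sq_norm X : C := \sum_i `|X i| ^+ 2.

Lemma eq_multi_prod U V X : (forall k, U k = V k) ->
  multi_prod U X = multi_prod V X.
Proof.
move=> e; apply/ffunP => i; rewrite !ffunE; apply: eq_bigr => l _.
by congr (_ * _); apply: eq_bigr => k _; rewrite e.
Qed.

Lemma multi_prodM U V X :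
  multi_prod U (multi_prod V X) = multi_prod (fun k => U k *m V k) X.
Proof.
apply/ffunP => i; rewrite !ffunE.
under eq_bigr do rewrite ffunE mulr_sumr.
rewrite exchange_big /=; apply: eq_bigr => m _.
under [in RHS]eq_bigr do rewrite mxE.
rewrite bigA_distr_midx mulr_suml; apply: eq_bigr => l _.
by rewrite mulrA big_split.
Qed.

Lemma prod_eq_midx (i l : midx n) : \prod_k ((i k == l k)%:R : C) = (i == l)%:R.
Proof.
case: eqVneq => [->|il]; first by rewrite big1 // => k _; rewrite eqxx.
have [k ik] : exists k, i k != l k.
  apply/existsP; rewrite -negb_forall; apply: contra il => /forallP e.
  by apply/eqP/ffunP => k; apply/eqP.
by rewrite (bigD1 k) //= (negPf ik) mul0r.
Qed.

Lemma multi_prod1 X : multi_prod (fun k => 1%:M) X = X.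
Proof.
apply/ffunP => i; rewrite ffunE.
under eq_bigr => l _.
  under eq_bigr do rewrite mxE.
  rewrite prod_eq_midx; over.
rewrite (bigD1 i) //= eqxx mul1r big1 ?addr0 // => l li.
by rewrite eq_sym (negPf li) mul0r.
Qed.

Lemma multi_prodB U X Y :
  multi_prod U (X - Y) = multi_prod U X - multi_prod U Y.
Proof.
apply/ffunP => i; rewrite !ffunE -sumrB; apply: eq_bigr => l _.
by rewrite !ffunE mulrBr.
Qed.

Lemma multi_prod_sum (I : finType) U (F : I -> {ffun midx n -> C}) :
  multi_prod U (\sum_t F t) = \sum_t multi_prod U (F t).
Proof.
apply/ffunP => i; rewrite sum_ffunE ffunE.
under eq_bigr do rewrite sum_ffunE mulr_sumr.
by rewrite exchange_big; apply: eq_bigr => t _; rewrite ffunE.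
Qed.

(** The Kronecker product has orthonormal columns: their inner products factor over the modes. *)
Lemma sq_norm_multi_prod U X : (forall k, U k \is unitarymx) ->
  sq_norm (multi_prod U X) = sq_norm X.
Proof.
move=> U_unitary; rewrite /sq_norm.
have orth (l m : midx n) :
    \sum_(i : midx n) \prod_k (U k (i k) (l k) * (U k (i k) (m k))^*) =
    (l == m)%:R.
  rewrite -(bigA_distr_midx (fun k a => U k a (l k) * (U k a (m k))^*)).
  rewrite -prod_eq_midx; apply: eq_bigr => k _.
  have /unitarymxP/mulmx1C/matrixP/(_ (m k) (l k)) := U_unitary k.
  rewrite !mxE eq_sym => <-; apply: eq_bigr => a _.
  by rewrite !mxE mulrC.
transitivity (\sum_(i : midx n) \sum_l \sum_m (X l * (X m)^*) *
    \prod_k (U k (i k) (l k) * (U k (i k) (m k))^*)).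
  apply: eq_bigr => i _; rewrite normCK ffunE raddf_sum big_distrlr /=.
  apply: eq_bigr => l _; apply: eq_bigr => m _.
  by rewrite rmorphM rmorph_prod big_split /= mulrACA mulrC.
rewrite exchange_big /=; apply: eq_bigr => l _; rewrite exchange_big /=.
under eq_bigr do rewrite -mulr_sumr orth.
rewrite (bigD1 l) //= eqxx mulr1 normCK big1 ?addr0 // => m ml.
by rewrite eq_sym (negPf ml) mulr0.
Qed.

(** The kernel splits into [Ka], acting before the cut, and [Kb], acting after it. As each is summed
    over full multi-indices, the terms are counted [#|midx n|] times; the prefix factor is divided
    by this number. *)
Lemma cut_rank_multi_prod U X j r :
  cut_rank_le j r X -> cut_rank_le j r (multi_prod U X).
Proof.
move=> [a [b [ha hb XE]]].
pose Ka (i p : midx n) := \prod_(k < d | (k < j)%N) U k (i k) (p k).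
pose Kb (i p : midx n) := \prod_(k < d | ~~ (k < j)%N) U k (i k) (p k).
exists (fun l i => (\sum_p Ka i p * a l p) / #|{: midx n}|%:R).
exists (fun l i => \sum_p Kb i p * b l p); split=> [l i i' e|l i i' e|i].
- congr (_ / _); apply: eq_bigr => p _; congr (_ * _).
  by apply: eq_bigr => k kj; rewrite e.
- apply: eq_bigr => p _; congr (_ * _).
  by apply: eq_bigr => k; rewrite -leqNgt => /e ->.
- have M0 : #|{: midx n}|%:R != 0 :> C.
    by rewrite pnatr_eq0 -lt0n; apply/card_gt0P; exists i.
  rewrite ffunE; under eq_bigr do rewrite XE mulr_sumr.
  rewrite exchange_big /=; apply: eq_bigr => l _.
  rewrite mulrAC (@sum_prefix_suffix _ _ _ j (fun p => Ka i p * a l p)).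
  + rewrite -mulr_natr mulfK //; apply: eq_bigr => p _.
    rewrite (bigID (fun k : 'I_d => (k < j)%N)) /= -/(Ka i p) -/(Kb i p).
    exact: mulrACA.
  + move=> p p' e; congr (_ * _); last exact: ha.
    by apply: eq_bigr => k kj; rewrite e.
  + move=> p p' e; congr (_ * _); last exact: hb.
    by apply: eq_bigr => k; rewrite -leqNgt => /e ->.
Qed.

End ModeTransforms.

(** * Mode products as transforms that are trivial in all modes but one *)

Section ModeProducts.
Variables (R : realType) (d : nat) (n : 'I_d -> nat).
Implicit Types X : tensor R n.

Lemma mode_prod_multi X k (A : 'M[R[i]]_(n k)) :
  mode_prod X A = multi_prod (dfwith (fun=> 1%:M) A) X.
Proof.
apply/ffunP => i; rewrite !ffunE.
rewrite [RHS](partition_big (fun l : midx n => l k) xpredT) //=.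
apply: eq_bigr => m _; pose l0 : midx n := [ffun t => dfwith i m t].
have l0k : l0 k = m by rewrite ffunE dfwith_in.
(* Any [l] other than [l0] with the same mode [k] differs from [i] in another mode, where the
   identity matrix contributes a zero. *)
rewrite (bigD1 l0) ?l0k //= [X in _ + X]big1 => [|l /andP[/eqP lk ll0]].
  rewrite addr0 mulrC (bigD1 k) //= dfwith_in l0k big1 ?mulr1 // => s sk.
  by rewrite dfwith_out 1?eq_sym // ffunE dfwith_out 1?eq_sym // mxE eqxx.
have [s sl] : exists s, l s != l0 s.
  apply/existsP; rewrite -negb_forall; apply: contra ll0 => /forallP e.
  by apply/eqP/ffunP => t; apply/eqP/e.
have ks : k != s by apply: contraNneq sl => <-; rewrite lk l0k.
rewrite (bigD1 s) //= dfwith_out // mxE.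
by move: sl; rewrite ffunE dfwith_out // eq_sym => /negPf ->; rewrite !mul0r.
Qed.

(** This diagonalizes one term of the Sylvester equation. Both sides are Kronecker products,
    compared mode by mode: [UA] in the mode [k], a commutation with the identity elsewhere. *)
Lemma multi_prod_mode_prod (U : forall k, 'M[R[i]]_(n k)) X k (A : 'M_(n k))
    (D : 'rV_(n k)) i : U k *m A = diag_mx D *m U k ->
  multi_prod U (mode_prod X A) i = D 0 (i k) * multi_prod U X i.
Proof.
move=> UA; transitivity (mode_prod (multi_prod U X) (diag_mx D) i).
  rewrite !mode_prod_multi !multi_prodM; congr (fun_of_fin _ i).
  apply: eq_multi_prod => s.
  case: (eqVneq k s) => [<-|ks]; first by rewrite !dfwith_in.
  by rewrite !dfwith_out // mulmx1 mul1mx.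
rewrite ffunE (bigD1 (i k)) //= big1 => [|m mi]; last first.
  by rewrite mxE eq_sym (negPf mi) mulr0n mulr0.
rewrite addr0 mxE eqxx mulr1n mulrC; congr (_ * multi_prod U X _).
by apply/ffunP => s; rewrite ffunE; case: dfwithP.
Qed.

End ModeProducts.

(** * Eigenbases of normal matrices *)

Section Spectral.
Variables (C : numClosedFieldType) (m : nat) (A : 'M[C]_m).

Lemma mul_spectralmx : A \is normalmx ->
  spectralmx A *m A = diag_mx (spectral_diag A) *m spectralmx A.
Proof.
move=> /orthomx_spectralP eA; rewrite [X in _ *m X = _]eA !mulmxA.
by rewrite mulmxV ?mul1mx // spectral_unit.
Qed.

(** Row [a] of the spectral matrix is a left eigenvector; it is nonzero because that matrix is
    invertible. *)
Lemma eigenvalue_spectral_diag a : A \is normalmx ->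
  eigenvalue A (spectral_diag A 0 a).
Proof.
move=> A_normal; apply/eigenvalueP; exists (row a (spectralmx A)).
  by rewrite -row_mul mul_spectralmx // row_mul row_diag_mx -scalemxAl -rowE.
apply: contraTneq isT => r0.
have := row_mul a (spectralmx A) (invmx (spectralmx A)).
rewrite mulmxV ?spectral_unit // r0 mul0mx => /rowP/(_ a)/eqP.
by rewrite !mxE eqxx oner_eq0.
Qed.

End Spectral.

(** * Bezoutians and Zolotarev numbers *)

(** For fixed [y], the left side is a polynomial in [x] that vanishes at [y]; the [b l y] are the
    [k] coefficients of its quotient by ['X - y%:P]. *)
Lemma bezoutian (K : fieldType) k (p q : {poly K}) :
    (size p <= k.+1)%N -> (size q <= k.+1)%N ->
  exists b : 'I_k -> K -> K, forall x y,
    q.[x] * p.[y] - p.[x] * q.[y] = (x - y) * \sum_(l < k) x ^+ l * b l y.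
Proof.
move=> szp szq; pose f y : {poly K} := p.[y] *: q - q.[y] *: p.
exists (fun l y => (f y %/ ('X - y%:P))`_l) => x y.
have szf : (size (f y) <= k.+1)%N.
  rewrite (leq_trans (size_polyD _ _)) // size_polyN geq_max.
  by rewrite !(leq_trans (size_scale_leq _ _)).
have fE : f y = (f y %/ ('X - y%:P)) * ('X - y%:P).
  by rewrite divpK // dvdp_XsubCl /root !hornerE mulrC subrr.
have szg : (size (f y %/ ('X - y%:P))%R <= k)%N.
  by rewrite size_divp ?polyXsubC_eq0 // size_XsubC leq_subLR add1n.
transitivity (f y).[x]; first by rewrite /f !hornerE mulrC [q.[y] * _]mulrC.
rewrite [in LHS]fE !hornerE mulrC (horner_coef_wide _ szg); congr (_ * _).
by apply: eq_bigr => l _; rewrite mulrC.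
Qed.

(** A finite supremum excludes zeros of [q] on [E], a nonzero infimum excludes zeros of [p] on [F].
    With denominators cleared, the inequality also covers the poles of [p / q] in [F]. *)
Lemma zolo_ltP (R : realType) k (E F : set R[i]) (c : R) : 0 <= c ->
    (zolo k E F < c%:E)%E ->
  exists p q : {poly R[i]}, [/\ (size p <= k.+1)%N, (size q <= k.+1)%N &
    forall z w, E z -> F w -> [/\ q.[z] != 0, p.[w] != 0 &
      `|p.[z]| * `|q.[w]| <= c%:C%C * (`|q.[z]| * `|p.[w]|)]].
Proof.
move=> c_ge0 /ereal_inf_lt[x [p [q [szp szq q0 cpq ->]]]].
rewrite /zolo_quotient; set num := ereal_sup _; set den := ereal_inf _.
case: ifPn => [_|/norP[num_fin den_neq0] quo_lt]; first by rewrite ltNge leey.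
exists p, q; split=> // z w Ez Fw.
have num_ge : (abs_ratfun p q z <= num)%E by apply: ereal_sup_ubound; exists z.
have den_le : (den <= abs_ratfun p q w)%E by apply: ereal_inf_lbound; exists w.
have abs_ge0 u : (0 <= abs_ratfun p q u)%E.
  rewrite /abs_ratfun; case: ifP => _; first exact: leey.
  by rewrite lee_fin; case: (_ / _) => a b; apply: sqrtr_ge0.
have den_ge0 : (0 <= den)%E.
  by apply: le_ereal_inf_tmp => _ [u _ <-]; apply: abs_ge0.
have num_ge0 : (0 <= num)%E := le_trans (abs_ge0 z) num_ge.
have qz : q.[z] != 0.
  apply: contraNneq num_fin => qz.
  by move: num_ge; rewrite /abs_ratfun /root qz eqxx leye_eq.
have pw : p.[w] != 0.
  apply: contraNneq den_neq0 => pw; rewrite eq_le den_ge0 andbT.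
  (* Coprimality prevents a pole at [w] from hiding the zero of [p]. *)
  move: den_le; rewrite /abs_ratfun; case: ifP => [qw|_].
    have rpw : root p w by apply/eqP.
    by have := coprimep_root cpq rpw; rewrite (eqP qw) eqxx.
  by rewrite pw mul0r Normc.normc0.
split=> //.
have [qw|qw] := eqVneq q.[w] 0.
  by rewrite qw normr0 mulr0 !mulr_ge0 // ler0c.
have nE (u : R[i]) : (Normc.normc u)%:C%C = `|u| by [].
have rE u : q.[u] != 0 -> abs_ratfun p q u = (Normc.normc (p.[u] / q.[u]))%:E.
  by rewrite /abs_ratfun /root => /negPf ->.
(* As [w] is not a pole, [den] is finite, hence a positive real. *)
have num_le : (num <= c%:E * den)%E.
  move: den_le den_ge0 den_neq0 quo_lt; rewrite rE //.
  case: den => [e||] //; rewrite lee_fin => _ e_ge0 e_neq0.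
  have e_gt0 : 0 < e by rewrite lt_neqAle eq_sym e_neq0 -lee_fin.
  by rewrite inver gt_eqF // lte_pdivrMr // => /ltW.
have := le_trans num_ge (le_trans num_le (lee_wpmul2l _ den_le)).
rewrite lee_fin => /(_ c_ge0); rewrite !rE // -EFinM lee_fin -lecR rmorphM /=.
rewrite !nE !normf_div mulrA ler_pdivrMr ?normr_gt0 //.
by rewrite mulrAC ler_pdivlMr ?normr_gt0 // -mulrA [`|p.[w]| * _]mulrC.
Qed.

(** * Low-rank approximation at a single cut *)

Lemma cut_rank_le_card (C : pzSemiRingType) d (n : 'I_d -> nat) j (I : finType)
    (T : {ffun midx n -> C}) (a b : I -> midx n -> C) :
    (forall t, prefix_only j (a t)) -> (forall t, suffix_only j (b t)) ->
    (forall i, T i = \sum_t a t i * b t i) ->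
  cut_rank_le j #|I| T.
Proof.
move=> ha hb TE; exists (a \o enum_val), (b \o enum_val).
split=> [l|l|i]; [exact: ha|exact: hb|].
by rewrite TE (reindex _ (onW_bij _ (@enum_val_bij I))).
Qed.

Section LowRank.
Variables (R : realType) (d : nat) (n : 'I_d -> nat).
Implicit Types X G Y : tensor R n.

Lemma cut_rank_separated_quotient X G (la mu : midx n -> R[i]) (E F : set R[i])
    (c : R) j k r :
    prefix_only j la -> suffix_only j mu ->
    (forall i, E (la i)) -> (forall i, F (mu i)) ->
    (forall i, (la i - mu i) * X i = G i) ->
    0 <= c -> (zolo k E F < c%:E)%E -> cut_rank_le j r G ->
  exists2 Y, cut_rank_le j (k * r) Y &
    sq_norm (X - Y) <= c%:C%C ^+ 2 * sq_norm X.
Proof.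
move=> hla hmu Ela Fmu XG c_ge0 /(zolo_ltP c_ge0)[p [q [szp szq pqP]]].
move=> [a [b [ha hb GE]]].
have [h hE] := bezoutian szp szq.
pose Y : tensor R n := [ffun i => X i *
  (1 - (p.[la i] * q.[mu i]) / (q.[la i] * p.[mu i]))].
exists Y.
  rewrite -{1}(card_ord k) -{1}(card_ord r) -card_prod.
  (* The factor [la i - mu i] of the Bezoutian is absorbed by [X i], which leaves [G i]; pairing the
     [k] terms of the Bezoutian with the [r] terms of [G] gives the separated sum. *)
  pose u (t : 'I_k * 'I_r) i := la i ^+ t.1 / q.[la i] * a t.2 i.
  pose v (t : 'I_k * 'I_r) i := h t.1 (mu i) / p.[mu i] * b t.2 i.
  apply: (@cut_rank_le_card _ _ _ _ _ _ u v) => [t i i' e|t i i' e|i].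
  - by rewrite /u (hla _ _ e) (ha _ _ _ e).
  - by rewrite /v (hmu _ _ e) (hb _ _ _ e).
  have [qla pmu _] := pqP _ _ (Ela i) (Fmu i).
  rewrite -(pair_bigA _ (fun l m => u (l, m) i * v (l, m) i)) /=.
  transitivity (\sum_(l < k) la i ^+ l * h l (mu i) *
      (G i / (q.[la i] * p.[mu i]))).
    rewrite -mulr_suml -XG ffunE.
    set s := \sum_(_ < _) _; have se := hE (la i) (mu i); rewrite -/s in se.
    rewrite -[1](@divff _ (q.[la i] * p.[mu i])) ?mulf_neq0 // -mulrBl se.
    by ring.
  apply: eq_bigr => l _; rewrite GE mulr_suml mulr_sumr.
  apply: eq_bigr => m _; rewrite /u /v /= invfM.
  by ring.
rewrite /sq_norm mulr_sumr; apply: ler_sum => i _.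
have [qla pmu le_c] := pqP _ _ (Ela i) (Fmu i).
(* The entry of [X - Y] is [X i] times the quotient of [p / q] at [la i] by [p / q] at [mu i]. *)
have err_le : `|(X - Y) i| <= c%:C%C * `|X i|.
  rewrite !ffunE mulrBr mulr1 opprB addrC subrK normrM mulrC ler_wpM2r //.
  by rewrite normf_div !normrM ler_pdivrMr ?mulr_gt0 ?normr_gt0.
rewrite -exprMn; apply: lerXn2r (err_le); rewrite nnegrE //.
exact: le_trans err_le.
Qed.

Lemma low_cut_rank_approx (A : forall k : 'I_d, 'M[R[i]]_(n k)) X G E F j k c :
    \sum_(k < d) mode_prod X (A k) = G -> (forall k, A k \is normalmx) ->
    minkowski_sum_separated A E F -> (0 < j < d)%N ->
    0 <= c -> (zolo k (E j) (F j) < c%:E)%E ->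
  exists2 Y, cut_rank_le j (k * \rank (unfolding G j)) Y &
    sq_norm (X - Y) <= c%:C%C ^+ 2 * sq_norm X.
Proof.
move=> XG A_normal A_sep jP c_ge0 zolo_lt.
have [_ subE subF] := A_sep j jP.
pose U k := spectralmx (A k).
have U_unitary s : U s \is unitarymx := spectral_unitarymx (A s).
pose D s := spectral_diag (A s).
have UA s : U s *m A s = diag_mx (D s) *m U s by apply: mul_spectralmx.
have spD s a : spectrum (A s) (D s 0 a) by apply: eigenvalue_spectral_diag.
pose la (i : midx n) := \sum_(s < d | (s < j)%N) D s 0 (i s).
(* The sign places [mu i] in [F j] and makes [la i - mu i] the sum of the eigenvalues over all
   modes. *)
pose mu (i : midx n) := - \sum_(s < d | (j <= s)%N) D s 0 (i s).
have [||||||||Y Yrank Yerr] := @cut_rank_separated_quotient (multi_prod U X)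
    (multi_prod U G) la mu (E j) (F j) c j k (\rank (unfolding G j)).
- by move=> i i' e; apply: eq_bigr => s sj; rewrite e.
- by move=> i i' e; congr (- _); apply: eq_bigr => s sj; rewrite e.
- by move=> i; apply: subE; exists (fun s => D s 0 (i s)).
- move=> i; apply: subF; exists (- mu i); last by rewrite opprK.
  by exists (fun s => D s 0 (i s)) => //; rewrite opprK.
- move=> i; rewrite -XG multi_prod_sum sum_ffunE opprK.
  under [RHS]eq_bigr do rewrite (multi_prod_mode_prod (U := U) _ _ (UA _)).
  rewrite -mulr_suml [in RHS](bigID (fun s : 'I_d => (s < j)%N)) /=.
  congr ((_ + _) * _).
  by apply: eq_bigl => s; rewrite leqNgt.
- exact: c_ge0.
- exact: zolo_lt.
- exact/cut_rank_multi_prod/cut_rank_unfolding.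
(* The way back to the original bases is unitary too, so it preserves both the cut rank bound and
   the error. *)
pose V s := (U s)^t*; exists (multi_prod V Y); first exact: cut_rank_multi_prod.
have VU : multi_prod V (multi_prod U X) = X.
  rewrite multi_prodM -[RHS]multi_prod1; apply: eq_multi_prod => s.
  by apply: mulmx1C; apply/unitarymxP.
have V_unitary s : V s \is unitarymx by rewrite trmxC_unitary.
rewrite -{1}VU -multi_prodB sq_norm_multi_prod // (le_trans Yerr) //.
by rewrite sq_norm_multi_prod.
Qed.

End LowRank.

(** * Orthogonal projections of matrix rows *)

Section Projectors.
Variables (C : numClosedFieldType) (m n : nat).
Implicit Types (B : 'M[C]_(m, n)) (P : 'M[C]_n).

Definition mx_sq_norm B : C := \sum_s \sum_p `|B s p| ^+ 2.

Lemma mx_sq_norm_ge0 B : 0 <= mx_sq_norm B.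
Proof. by do 2!(apply: sumr_ge0 => ? _); rewrite exprn_ge0. Qed.

Lemma mx_sq_normE B : mx_sq_norm B = \tr (B *m B^t*).
Proof.
apply: eq_bigr => s _; rewrite mxE; apply: eq_bigr => p _.
by rewrite !mxE normCK.
Qed.

Lemma mx_sq_norm_proj B P : P^t* = P -> P *m P = P ->
  mx_sq_norm B = mx_sq_norm (B *m P) + mx_sq_norm (B *m (1%:M - P)).
Proof.
have sq Q : Q^t* = Q -> Q *m Q = Q ->
    mx_sq_norm (B *m Q) = \tr (B *m Q *m B^t*).
  move=> Qh Qi; rewrite mx_sq_normE trmx_mul map_mxM Qh.
  by rewrite mulmxA -[B *m Q *m Q]mulmxA Qi.
move=> Ph Pi; rewrite !sq // -?mxtraceD -?mulmxDl -?mulmxDr.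
- by rewrite addrC subrK mulmx1 mx_sq_normE.
- by rewrite linearB /= map_mxB Ph trmx1 map_mx1.
- by rewrite mulmxBl mul1mx mulmxBr mulmx1 Pi subrr subr0.
Qed.

(** The component along [P] is [(X - Z) *m P]; the other one is [X *m (1%:M - P)], equal to
    [(X - Y) *m (1%:M - P)] because [P] fixes [Y]. Thus squared errors add, whatever [Z] is. *)
Lemma mx_sq_norm_sub_proj (X Y Z : 'M[C]_(m, n)) P :
    P^t* = P -> P *m P = P -> Y *m P = Y ->
  mx_sq_norm (X - Z *m P) <= mx_sq_norm (X - Y) + mx_sq_norm (X - Z).
Proof.
move=> Ph Pi YP; rewrite (mx_sq_norm_proj (X - Z *m P) Ph Pi).
have le1 B : mx_sq_norm (B *m P) <= mx_sq_norm B.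
  by rewrite [leRHS](mx_sq_norm_proj B Ph Pi) lerDl mx_sq_norm_ge0.
have le2 B : mx_sq_norm (B *m (1%:M - P)) <= mx_sq_norm B.
  by rewrite [leRHS](mx_sq_norm_proj B Ph Pi) lerDr mx_sq_norm_ge0.
rewrite addrC; apply: lerD; last first.
  by rewrite mulmxBl -mulmxA Pi -mulmxBl.
have -> : (X - Z *m P) *m (1%:M - P) = (X - Y) *m (1%:M - P); last exact: le2.
by rewrite !mulmxBr !mulmxBl !mulmx1 -mulmxA Pi YP !opprB !addrA !subrK.
Qed.

End Projectors.

(** * Orthogonal projections of tensors at a cut *)

Section CutProjections.
Variables (C : numClosedFieldType) (d : nat) (n : 'I_d -> nat).
Implicit Types X Y Z : {ffun midx n -> C}.

(* The inner sum meets every value of the first j modes once for each value of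
   the others; b absorbs this multiplicity. *)
Definition cut_op j r (a b : 'I_r -> midx n -> C) Z : {ffun midx n -> C} :=
  [ffun i => \sum_l a l i * \sum_p b l p * Z (midx_merge j p i)].

(** This rank-one operator ends the sweep at the cut 0 without error. *)
Lemma cut_op0 Z :
  cut_op 0 (fun (_ : 'I_1) _ => 1) (fun _ _ => #|{: midx n}|%:R^-1) Z = Z.
Proof.
apply/ffunP => i; rewrite ffunE big_ord1 mul1r.
under eq_bigr do rewrite midx_merge0.
rewrite sumr_const -mulrnAl -[_ *+ _]mulr_natl mulfV ?mul1r //.
by rewrite pnatr_eq0 -lt0n; apply/card_gt0P; exists i.
Qed.

(* Both the rows and the columns are indexed by full multi-indices, of which
   only the modes >= j, respectively < j, matter: every entry of Z occurs
   #|midx n| times. *)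
Let cutmx j Z : 'M[C]_#|{: midx n}| :=
  \matrix_(s, p) Z (midx_merge j (enum_val p) (enum_val s)).

Let mx_sq_norm_cutmx j Z :
  mx_sq_norm (cutmx j Z) = sq_norm Z *+ #|{: midx n}|.
Proof.
rewrite /sq_norm -(sum_merge1 j) exchange_big /=.
rewrite [RHS](reindex _ (onW_bij _ (@enum_val_bij _))); apply: eq_bigr => s _.
rewrite [RHS](reindex _ (onW_bij _ (@enum_val_bij _))); apply: eq_bigr => p _.
by rewrite mxE.
Qed.

(** The operator is the orthogonal projection onto the row space of the cut matrix of [Y], whose
    rank is at most [r]. The quantification over [Z] allows its use on tensors already projected at
    other cuts. *)
Lemma cut_projection X Y j r : cut_rank_le j r Y ->
  exists s (a b : 'I_s -> midx n -> C),
    [/\ (s <= r)%N, forall l, prefix_only j (a l) &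
        forall Z, sq_norm (X - cut_op j a b Z) <=
                  sq_norm (X - Y) + sq_norm (X - Z)].
Proof.
move=> [a [b [ha hb YE]]]; set Ym := cutmx j Y.
pose V := schmidt (row_base Ym).
have VV : V *m V^t* = 1%:M.
  exact/unitarymxP/schmidt_unitarymx/rank_leq_row.
have [W YW] : exists W, Ym = W *m V.
  apply/submxP; rewrite -(eq_row_base Ym); exact: schmidt_sub.
(* Since [V] is recovered from the rows of [Ym], its entries depend on the column index only through
   the first [j] modes. *)
have [W' VW'] : exists W', V = W' *m Ym.
  apply/submxP; rewrite -(eq_row_base Ym).
  by rewrite (eqmx_schmidt_free (row_base_free _)).
pose P := V^t* *m V.
have Ph : P^t* = P by rewrite trmx_mul map_mxM trmxCK.
have Pi : P *m P = P by rewrite /P mulmxA -[_ *m V *m _]mulmxA VV mulmx1.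
have YP : Ym *m P = Ym by rewrite YW -mulmxA [V *m _]mulmxA VV mul1mx.
have V_prefix l : prefix_only j (fun i => V l (enum_rank i)).
  move=> i i' e; rewrite VW' !mxE; apply: eq_bigr => s _; congr (_ * _).
  rewrite !mxE !enum_rankK; congr (Y _); apply/ffunP => k; rewrite !ffunE.
  by case: ifP => // /e.
exists (\rank Ym), (fun l i => V l (enum_rank i)).
exists (fun l i => (V l (enum_rank i))^*); split=> [|//|Z].
- have -> : Ym = (\matrix_(s, l) b l (enum_val s)) *m
                 (\matrix_(l, p) a l (enum_val p)).
    apply/matrixP => s p; rewrite !mxE YE; apply: eq_bigr => l _.
    by rewrite !mxE mulrC (prefix_merge _ _ (ha l)) (suffix_merge _ _ (hb l)).
  exact: mulmx_max_rank.
set T := cut_op _ _ _ Z.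
have TE : cutmx j T = cutmx j Z *m P.
  apply/matrixP => s p; rewrite mulmxA !mxE ffunE; apply: eq_bigr => l _.
  rewrite (prefix_merge _ _ (V_prefix l)) enum_valK mulrC mxE; congr (_ * _).
  rewrite (reindex _ (onW_bij _ (@enum_val_bij _))); apply: eq_bigr => q _.
  by rewrite !mxE enum_valK midx_merge_merge mulrC.
(* The multiplicity [#|midx n|] of the cut matrices is cancelled below; if it is 0, all norms are
   empty sums. *)
have [M0|M_gt0] := posnP #|{: midx n}|.
  rewrite {1}/sq_norm big1 ?addr_ge0 ?sumr_ge0 // => i.
  by case: (fintype0 i M0).
rewrite -(ler_pMn2r M_gt0) mulrnDl -!(mx_sq_norm_cutmx j).
have cutmxB (Z1 Z2 : {ffun midx n -> C}) :
    cutmx j (Z1 - Z2) = cutmx j Z1 - cutmx j Z2.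
  by apply/matrixP => s p; rewrite !mxE !ffunE.
rewrite !cutmxB TE; exact: mx_sq_norm_sub_proj.
Qed.

End CutProjections.

(** * Successive projections and the tensor-train cores *)

Section CutSweep.
Variables (R : realType) (d : nat) (n : 'I_d -> nat).
Variables (s : nat -> nat) (a b : forall j, 'I_(s j) -> midx n -> R[i]).
Implicit Types X Z : tensor R n.

Fixpoint cut_sweep m Z : tensor R n :=
  if m is m'.+1 then cut_sweep m' (cut_op m' (@a m') (@b m') Z) else Z.

(** The operators of the cuts below [m] only mix the first [m] modes, so functions of the other
    modes pass through them as scalars. *)
Lemma cut_sweep_suffix (I : finType) m (f : I -> tensor R n)
    (h : I -> midx n -> R[i]) : (forall t, suffix_only m (h t)) ->
  cut_sweep m [ffun i => \sum_t f t i * h t i] =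
  [ffun i => \sum_t cut_sweep m (f t) i * h t i].
Proof.
elim: m f => [//|m IHm] f hh /=.
have hm t : suffix_only m (h t) by apply: suffix_onlyW (hh t).
rewrite -IHm //; congr cut_sweep; apply/ffunP => i; rewrite !ffunE.
under [RHS]eq_bigr do rewrite ffunE mulr_suml.
rewrite exchange_big /=; apply: eq_bigr => l _.
under eq_bigr do rewrite ffunE mulr_sumr.
rewrite exchange_big /= mulr_sumr; apply: eq_bigr => t _.
rewrite -mulrA mulr_suml; congr (_ * _); apply: eq_bigr => p _.
by rewrite (suffix_merge _ _ (hm t)) mulrA.
Qed.

Lemma cut_sweep_err (X Z : tensor R n) (e : nat -> R[i]) m :
    (forall j W, (j < m)%N ->
      sq_norm (X - cut_op j (@a j) (@b j) W) <= e j + sq_norm (X - W)) ->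
  sq_norm (X - cut_sweep m Z) <= \sum_(j < m) e j + sq_norm (X - Z).
Proof.
elim: m Z => [|m IHm] Z he /=; first by rewrite big_ord0 add0r.
apply: le_trans (IHm _ _) _ => [j W jm|]; first exact/he/leqW.
by rewrite big_ord_recr /= -addrA lerD2l he.
Qed.

(** The basis at the cut [k.+1], for each value [x] of the mode [k], in coordinates with respect to
    the basis at the cut [k]; [b] plays the role of the dual basis. *)
Let core (k : 'I_d) (x : 'I_(n k)) : 'M[R[i]]_(s k, s k.+1) :=
  \matrix_(l, l') \sum_(p : midx n) b l p * a l' [ffun t => dfwith p x t].

Hypothesis s0 : s 0 = 1%N.
Hypothesis a0 : forall (l : 'I_(s 0)) i, a l i = 1.
Hypothesis a_prefix : forall j (l : 'I_(s j)), prefix_only j (a l).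

Lemma cut_sweep_tt m (le_md : (m <= d)%N) (i : midx n) (u : 'I_(s 0))
    (l : 'I_(s m)) :
  cut_sweep m [ffun i => a l i] i = tt_prod core i le_md u l.
Proof.
elim: m le_md l => [|m IHm] lt_md l /=.
  rewrite ffunE a0 mxE; suff -> : u == l by [].
  by case: u l => u hu [l hl]; apply/eqP/val_inj => /=; move: hu hl;
     rewrite s0 !ltnS !leqn0 => /eqP -> /eqP ->.
set k := Ordinal lt_md.
pose h (t : 'I_(s m)) (i : midx n) : R[i] := core (i k) t l.
(* Before the cut [m.+1], the merged multi-index is [p] with its mode [m] taken from [i']: the
   operator produces exactly one core. *)
have -> : cut_op m (@a m) (@b m) [ffun i => a l i] =
    [ffun i => \sum_t [ffun i' => a t i'] i * h t i].
  apply/ffunP => i'; rewrite !ffunE; apply: eq_bigr => t _.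
  rewrite ffunE /h mxE; congr (_ * _); apply: eq_bigr => p _; rewrite ffunE.
  congr (_ * _); apply: a_prefix => r; rewrite !ffunE ltnS leq_eqVlt.
  case: (eqVneq k r) => [<- _|kr]; first by rewrite ltnn dfwith_in.
  rewrite dfwith_out // => /orP[/eqP rm|-> //].
  by case/eqP: kr; apply: val_inj.
rewrite cut_sweep_suffix => [|t i1 i2 e]; last by rewrite /h e.
by rewrite ffunE mxE; apply: eq_bigr => t _; rewrite (IHm (ltnW lt_md)).
Qed.

(** The sweep starts from [X] itself, taken as the only basis function at the cut [d]. *)
Lemma tt_format_cut_sweep X : s d = 1%N ->
  (forall (l : 'I_(s d)) i, a l i = X i) -> tt_format s (cut_sweep d X).
Proof.
move=> sd ad; split=> //; exists core => i u l.
rewrite -cut_sweep_tt; congr (cut_sweep d _ i).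
by apply/ffunP => i'; rewrite ffunE ad.
Qed.

End CutSweep.

(** * Assembly of the storage bound *)

Lemma frob_le (R : realType) d (n : 'I_d -> nat) (X Y : tensor R n) (c : R) :
  0 <= c -> sq_norm Y <= c%:C%C ^+ 2 * sq_norm X -> frob Y <= c * frob X.
Proof.
move=> c_ge0.
have sqE Z : sq_norm Z = (\sum_i Normc.normc (Z i) ^+ 2)%:C%C.
  by rewrite rmorph_sum; apply: eq_bigr => i _; rewrite rmorphXn.
rewrite !sqE -rmorphXn -rmorphM lecR => le_sq.
rewrite -[c in leRHS]ger0_norm // -sqrtr_sqr /frob -sqrtrM ?sqr_ge0 //.
exact: ler_wsqrtr.
Qed.

Theorem theorem4p3 (R : realType) (d : nat) (n : 'I_d -> nat)
    (A : forall k : 'I_d, 'M[R[i]]_(n k)) (X G : tensor R n)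
    (E F : nat -> set R[i]) (eps : R) (kk : nat -> nat)
    (d_ge2 : (2 <= d)%N)
    (sylvester : \sum_(k < d) mode_prod X (A k) = G)
    (A_normal : forall k : 'I_d, A k \is normalmx)
    (A_sep : minkowski_sum_separated A E F)
    (eps_bounds : 0 < eps < 1)
    (kkP : forall j : nat, (0 < j < d)%N ->
      (zolo (kk j) (E j) (F j) <= (eps / Num.sqrt d%:R)%:E)%E) :
  let knu (j : nat) :=
    (if (0 < j < d)%N then kk j * \rank (unfolding G j) else 1)%N in
  (pTT eps X <= \sum_(j < d) knu j * knu j.+1 * n j)%N.
Proof.
pose knu j := if (0 < j < d)%N then (kk j * \rank (unfolding G j))%N else 1%N.
change (pTT eps X <= \sum_(j < d) knu j * knu j.+1 * n j)%N.
have /andP[eps_gt0 _] := eps_bounds.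
have d_gt0 : (0 < d)%N by apply: ltnW.
have dR_gt0 : 0 < d%:R :> R by rewrite ltr0n.
have d1_gt0 : 0 < d.-1%:R :> R by rewrite ltr0n -ltnS prednK.
(* Chosen so that [d.-1] squared errors of relative size [c] add up to [eps ^+ 2]. *)
pose c := eps / Num.sqrt d.-1%:R.
have c_ge0 : 0 <= c by rewrite divr_ge0 ?sqrtr_ge0 // ltW.
have zolo_lt j : (0 < j < d)%N -> (zolo (kk j) (E j) (F j) < c%:E)%E.
  move=> /kkP/le_lt_trans; apply; rewrite lte_fin ltr_pM2l //.
  by rewrite ltf_pV2 ?ltr_sqrt ?posrE ?sqrtr_gt0 // ltr_nat prednK.
pose e j : R[i] := if j == 0%N then 0 else c%:C%C ^+ 2 * sq_norm X.
pose family r := 'I_r -> midx n -> R[i].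
(* Rank and families of a cut are bundled so that one choice covers all [j]. The end cuts have rank
   1, with the constant 1 at the cut 0 and [X] at the cut [d]. *)
pose good j (t : {r & (family r * family r)%type}) :=
  [/\ (tag t <= knu j)%N, ~~ (0 < j < d)%N -> tag t = 1%N,
      forall l, prefix_only j ((tagged t).1 l),
      [/\ j = 0%N -> forall l i, (tagged t).1 l i = 1 &
          j = d -> forall l i, (tagged t).1 l i = X i] &
      (j < d)%N -> forall Z,
        sq_norm (X - cut_op j (tagged t).1 (tagged t).2 Z) <=
        e j + sq_norm (X - Z)].
have /choice[t tP] j : exists t, good j t.
  rewrite /good /knu /e; case: ifP => jP.
    have [Y Yrank Yerr] :=
      low_cut_rank_approx sylvester A_normal A_sep jP c_ge0 (zolo_lt j jP).
    have [r [a [b [r_le ha hZ]]]] := cut_projection X Yrank.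
    exists (existT _ r (a, b)); split=> //.
      by split=> j0; move: jP; rewrite j0 ?ltnn ?andbF.
    move=> _ Z; apply: le_trans (hZ Z) _.
    by rewrite lerD2r; case: eqP jP Yerr => // ->.
  case: (posnP j) => [->|j_gt0].
    exists (existT _ 1%N (fun=> fun=> 1, fun=> fun=> #|{: midx n}|%:R^-1)).
    split=> //=.
      by split=> // d0; case/eqP: (lt0n_neq0 d_gt0); rewrite -d0.
    by move=> _ Z; rewrite add0r cut_op0.
  (* Here [j] is at least [d], where no operator is applied; 0 is a default. *)
  exists (existT _ 1%N (fun _ i => X i, fun=> fun=> 0)); split=> //=.
  - move=> _ i i' ii'; congr (X _); apply/ffunP => k; apply: ii'.
    rewrite (leq_trans (ltn_ord k)) // leqNgt.
    by move: jP; rewrite j_gt0 => /= ->.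
  - by split=> // j0; move: j_gt0; rewrite j0.
  - by move: jP; rewrite j_gt0 /= => ->.
pose s j := tag (t j).
pose a j : 'I_(s j) -> midx n -> R[i] := (tagged (t j)).1.
pose b j : 'I_(s j) -> midx n -> R[i] := (tagged (t j)).2.
pose Y := cut_sweep a b d X.
have storable : tt_storable eps X (tt_dof n s).
  exists s, Y; split=> //.
    apply: tt_format_cut_sweep => //.
    - by have [_ h _ _ _] := tP 0%N; apply: h.
    - by have [_ _ _ [h _] _] := tP 0%N; apply: h.
    - by move=> j; have [] := tP j.
    - by have [_ h _ _ _] := tP d; apply: h; rewrite ltnn andbF.
    - by have [_ _ _ [_ h] _] := tP d; apply: h.
  apply: frob_le; first exact: ltW.
  apply: le_trans (@cut_sweep_err _ _ _ _ _ _ X X e d _) _.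
    by move=> j W jd; have [_ _ _ _ h] := tP j; apply: h.
  have sq0 : sq_norm (X - X) = 0.
    by rewrite subrr /sq_norm big1 // => i _; rewrite ffunE normr0 expr0n.
  (* Only the cut 0 is free of error: [d.-1] equal terms remain. *)
  rewrite sq0 addr0 (bigD1 (Ordinal d_gt0)) //= add0r.
  rewrite (eq_bigr (fun=> c%:C%C ^+ 2 * sq_norm X)) => [|j j_neq0]; last first.
    by rewrite /e ifN //; apply: contraNneq j_neq0 => j0; apply/eqP/val_inj.
  rewrite sumr_const cardC1 card_ord -mulrnAl -!rmorphXn -rmorphMn.
  by rewrite exprMn exprVn sqr_sqrtr ?ler0n // -mulr_natr mulfVK ?gt_eqF.
have [_ pTT_min] := pTTP (ex_intro _ _ storable).
apply: leq_trans (pTT_min _ storable) _.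
apply: leq_sum => j _; rewrite leq_mul2r leq_mul ?orbT //.
  by have [] := tP j.
by have [] := tP j.+1.
Qed.
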